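(* Let $\mathbb{K}$ be a field of characteristic $p>0$. For every integer $n\geq 2$, $$s_n(\mathbb{K})\leq 5+\Bigl[\frac{p-1}{n}\Bigr].$$ In particular, if $n\geq p$, then every matrix of $\mathrm{M}_n(\mathbb{K})$ whose trace lies in the prime subfield $\mathbb{F}_p$ of $\mathbb{K}$ is a sum of five idempotent matrices of $\mathrm{M}_n(\mathbb{K})$.
   Context: $\mathbb{F}_p$ denotes the prime subfield of $\mathbb{K}$. An idempotent matrix is a matrix $Q\in \mathrm{M}_n(\mathbb{K})$ with $Q^2=Q$ (so $0$ and $I_n$ are idempotents, and a sum of $N$ idempotents is also a sum of $N'$ idempotents for every $N'\geq N$). For $n\geq 1$, $s_n(\mathbb{K})$ denotes the lowest integer $N$ such that every matrix $A\in \mathrm{M}_n(\mathbb{K})$ with $\operatorname{tr} A\in\mathbb{F}_p$ is a sum of $N$ idempotent matrices of $\mathrm{M}_n(\mathbb{K})$. $[x]$ denotes the greatest integer $k$ such that $k\leq x$. *)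

(* Defs.v *)
From mathcomp Require Import all_boot all_order all_algebra.

Set Implicit Arguments.
Unset Strict Implicit.
Unset Printing Implicit Defensive.

Import GRing.Theory.
Local Open Scope ring_scope.

(* The intersection of all subfields of K. Restricting to boolean subfields is
   harmless in characteristic p, where the prime subfield is itself one: see
   in_prime_subfieldP. *)
Definition in_prime_subfield (K : fieldType) (x : K) : Prop :=
  forall S : {pred K}, divring_closed S -> x \in S.

Lemma in_prime_subfieldP (K : fieldType) (p : nat) (x : K) :
  p \in [pchar K] -> in_prime_subfield x <-> exists k : nat, x = k%:R.
Proof.
move=> pK; have p_pr := pcharf_prime pK; have p_gt0 := prime_gt0 p_pr.
split=> [Fx | [k ->] S [S1 SB _]]; last first.
  have S0 : 0 \in S by rewrite -(subrr 1) SB.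
  elim: k => // k IHk.
  by rewrite mulrS -[k%:R]opprK -[- k%:R]sub0r SB // SB.
pose S := [pred y : K | [exists k : 'I_p, y == (k : nat)%:R]].
have inS m : m%:R \in S.
  apply/existsP; exists (Ordinal (ltn_pmod m p_gt0)).
  by rewrite /= {1}(divn_eq m p) natrD natrM (pcharf0 pK) mulr0 add0r.
have SP y : y \in S -> exists k : nat, y = k%:R.
  by case/existsP=> k /eqP->; exists k.
apply/SP/Fx; split; first exact: (inS 1).
  move=> _ _ /SP[a ->] /SP[b ->].
  have -> : a%:R - b%:R = (a + p.-1 * b)%:R :> K; last exact: inS.
  rewrite natrD; congr (_ + _); apply/eqP.
  by rewrite eq_sym -subr_eq0 opprK -natrD addnC -mulSn prednK // natrM (pcharf0 pK) mul0r.
move=> _ _ /SP[a ->] /SP[b ->].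
have [-> | b0] := eqVneq (b%:R : K) 0; first by rewrite invr0 mulr0 (inS 0).
have -> : a%:R / b%:R = (a * b ^ p.-2)%:R :> K; last exact: inS.
rewrite natrM natrX; congr (_ * _).
apply: (mulfI b0); rewrite divff // -exprS prednK; last first.
  by case: (p) p_pr => [|[]].
apply: (mulfI b0); rewrite -exprS prednK // mulr1.
by rewrite -(pFrobenius_autE pK) pFrobenius_aut_nat.
Qed.

Definition idempotent_mx (K : fieldType) (n : nat) (Q : 'M[K]_n) : Prop :=
  Q *m Q = Q.

Definition sum_of_idempotents (K : fieldType) (n N : nat) (A : 'M[K]_n) : Prop :=
  exists Q : 'I_N -> 'M[K]_n,
    (forall i, idempotent_mx (Q i)) /\ A = \sum_(i < N) Q i.

Definition idempotent_bound (K : fieldType) (n N : nat) : Prop :=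
  forall A : 'M[K]_n, in_prime_subfield (\tr A) -> sum_of_idempotents N A.

(* is_s K n s means s = s_n(K). *)
Definition is_s (K : fieldType) (n s : nat) : Prop :=
  idempotent_bound K n s /\ (forall N : nat, idempotent_bound K n N -> (s <= N)%N).

Lemma is_s_unique (K : fieldType) (n s t : nat) : is_s K n s -> is_s K n t -> s = t.
Proof. by move=> [Bs ls] [Bt lt]; apply/eqP; rewrite eqn_leq ls ?lt. Qed.

(* Main.v *)
Require Import Defs.
From mathcomp Require Import all_boot all_order all_algebra.
From mathcomp Require Import zify ring.
From Stdlib Require Import Classical.

Import GRing.Theory.
Local Open Scope ring_scope.

(* Write n for the size of A. Subtracting multiples of the identity, which is
   idempotent, we may assume tr A = t with 2n < t <= 3n. Every matrix is similar
   to a Hessenberg one, and a lower bidiagonal matrix with unit diagonal (one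
   diagonal entry may also be 2) is a sum of two idempotents, each made of
   alternate columns; subtracting such a matrix replaces all the subdiagonal
   entries by 1. What remains is a matrix C with cyclic vector e_0 and
   tr C = n + s, where 0 < s < n. Put m = n - s - 1. In the basis p_j(C - 1) e_0,
   where the p_j are X^0, ..., X^m followed by X^m times the successive quotients
   by X - 1, in increasing degree, of the quotient of the characteristic polynomial
   of C - 1 by X^m, the matrix C - 1 becomes the sum of a subdiagonal of ones and
   of [[0, Y], [0, 1_s]]. The latter is idempotent, and the subdiagonal plus the
   identity is a sum of two idempotents as before, so C is a sum of three. *)

(** * Operations on sums of idempotents *)

Lemma sum_of_idempotents1 {K : fieldType} {n : nat} (Q : 'M[K]_n) :
  idempotent_mx Q -> sum_of_idempotents 1 Q.
Proof. by move=> idQ; exists (fun=> Q); rewrite big_ord1. Qed.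

Lemma sum_of_idempotents_nseq {K : fieldType} {n : nat} (N : nat) (Q : 'M[K]_n) :
  idempotent_mx Q -> sum_of_idempotents N (Q *+ N).
Proof. by move=> idQ; exists (fun=> Q); rewrite sumr_const card_ord. Qed.

Lemma sum_of_idempotentsD {K : fieldType} {n N1 N2 : nat} (A B : 'M[K]_n) :
  sum_of_idempotents N1 A -> sum_of_idempotents N2 B ->
  sum_of_idempotents (N1 + N2) (A + B).
Proof.
move=> [P [idP ->]] [Q [idQ ->]].
exists (fun i => match split i with inl j => P j | inr k => Q k end).
split=> [i|]; first by case: split.
rewrite big_split_ord; congr (_ + _); apply: eq_bigr => i _.
  by rewrite (unsplitK (inl i)).
by rewrite (unsplitK (inr i)).
Qed.

Lemma sum_of_idempotents_leq {K : fieldType} {n N1 N2 : nat} (A : 'M[K]_n) :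
  (N1 <= N2)%N -> sum_of_idempotents N1 A -> sum_of_idempotents N2 A.
Proof.
move=> le12 sA; rewrite -(subnKC le12) -[A]addr0.
apply: sum_of_idempotentsD sA _; rewrite -[0](mul0rn _ (N2 - N1)).
exact/sum_of_idempotents_nseq/mulmx0.
Qed.

Lemma sum_of_idempotents_similar {K : fieldType} {n N : nat} (S A M : 'M[K]_n) :
  S \in unitmx -> A *m S = S *m M ->
  sum_of_idempotents N M -> sum_of_idempotents N A.
Proof.
move=> uS AS [Q [idQ sumQ]].
exists (fun i => S *m Q i *m invmx S); split=> [i|].
  by rewrite /idempotent_mx !mulmxA mulmxKV // -(mulmxA S) idQ.
by rewrite -mulmx_suml -mulmx_sumr -sumQ -AS mulmxK.
Qed.

(** * Column idempotents and bidiagonal matrices *)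

(* In block form, with the indices in S listed first, this is [[1, 0], [Y, 0]]. *)
Definition column_idempotent {K : fieldType} (n : nat) (S : pred nat)
    (Y : nat -> nat -> K) : 'M[K]_n :=
  \matrix_(i, j) if S j then if S i then (i == j)%:R else Y i j else 0.

Lemma column_idempotentP {K : fieldType} (n : nat) (S : pred nat)
    (Y : nat -> nat -> K) :
  idempotent_mx (column_idempotent n S Y).
Proof.
apply/matrixP=> i j; rewrite mxE (bigD1 j) //= big1 => [|k kj]; last first.
  rewrite !mxE; case: (S j); last by rewrite mulr0.
  by case: (S k); rewrite ?mul0r // (negPf kj) mulr0.
by rewrite !mxE addr0; case: (S j); rewrite ?eqxx ?mulr1 ?mulr0.
Qed.

(** The flag [e] raises the corner entry to 2, a means of shifting the trace by one. *)
Definition bidiagonal {K : fieldType} (n : nat) (e : bool) (x : nat -> K) : 'M[K]_n :=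
  \matrix_(i, j) ((i == j)%:R + [&& e, (i == 0 :> nat)%N & (j == 0 :> nat)%N]%:R
                  + if i == j.+1 :> nat then x j else 0).

(** Even columns go to one idempotent, odd columns to the other: the subdiagonal entry of column [j]
    sits in row [j.+1], of opposite parity, hence outside the selected indices. If [e] holds, column
    0 is selected in both; the second copy only adds 1 at the corner, since row 1 is selected
    there. *)
Lemma bidiagonal_sum {K : fieldType} (n : nat) (e : bool) (x : nat -> K) :
  sum_of_idempotents 2 (bidiagonal n e x).
Proof.
pose Y (i j : nat) := if i == j.+1 then x j else 0.
pose odd0 i := odd i || e && (i == 0)%N.
suff -> : bidiagonal n e x = column_idempotent n (predC odd) Y
                           + column_idempotent n odd0 Y.
  by apply: (@sum_of_idempotentsD _ _ 1 1);
     apply/sum_of_idempotents1/column_idempotentP.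
apply/matrixP=> i j; rewrite !mxE /Y /odd0 /= -val_eqE /=.
move: (i : nat) (j : nat) => {}i {}j; clear Y odd0.
have [-> | ij] := eqVneq i j.
  rewrite (ltn_eqF (ltnSn j)); case: j => [|j] /=; case: e; rewrite //= ?orbF ?addr0 //.
  - by case: (odd _); rewrite /= ?addr0 ?add0r.
  - by case: (odd _); rewrite /= ?addr0 ?add0r.
have [-> | _] := eqVneq i j.+1.
  by rewrite andbF add0r; case: j {ij} => [|j] /=; case: e => //=;
    rewrite ?orbF; try case: (odd _); rewrite /= ?addr0 ?add0r.
by rewrite !if_same addr0; case: i j ij => [|i] [|j] //=; case: e; rewrite /= ?addr0.
Qed.

(** * Reduction to Hessenberg form *)

Definition hessenberg {K : fieldType} {n : nat} (H : 'M[K]_n) :=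
  forall i j : 'I_n, (j.+1 < i)%N -> H i j = 0.

(** Conjugating by a matrix that fixes the first basis vector makes the induction work: applied to
    the lower right block, it preserves a first column that is already cleared. *)
Lemma hessenberg_reduction_fix0 {K : fieldType} {n : nat} (A : 'M[K]_(1 + n)) :
  exists2 T : 'M[K]_n, T \in unitmx &
    hessenberg (block_mx 1%:M 0 0 T *m A *m block_mx 1%:M 0 0 (invmx T)).
Proof.
elim: n A => [|n IHn] A.
  by exists 1%:M; [exact: unitmx1 | move=> i j; rewrite !ord1].
rewrite -[A]submxK; set a := ulsubmx A; set b := ursubmx A.
set c : 'cV_n.+1 := dlsubmx A; set D : 'M_n.+1 := drsubmx A.
(* As [c] is a column, its rank is at most 1, so [T1 *m c] vanishes below its first entry. *)
pose T1 := invmx (col_ebase c).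
have uT1 : T1 \in unitmx by rewrite unitmx_inv col_ebase_unit.
have [T2 uT2 hT2] := IHn (T1 *m D *m invmx T1 : 'M_(1 + n)).
pose L : 'M[K]_(1 + n) := block_mx 1%:M 0 0 T2.
pose L' : 'M[K]_(1 + n) := block_mx 1%:M 0 0 (invmx T2).
have LL' : L *m L' = 1%:M.
  by rewrite mulmx_block !mulmx0 !mul0mx !mul1mx !addr0 !add0r mulmxV // -scalar_mx_block.
have [uL _] := mulmx1_unit LL'.
have uT : L *m T1 \in unitmx by rewrite unitmx_mul uL.
exists (L *m T1) => //.
have -> : invmx (L *m T1) = invmx T1 *m L'.
  by rewrite -[LHS]mulmx1; apply: (canLR (mulKmx uT)); rewrite !mulmxA mulmxK // LL'.
rewrite !mulmx_block !(mulmx0, mul0mx, mul1mx, addr0, add0r, mulmx1).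
move=> i j.
case: (split_ordP i) => i' ->; first by rewrite !ord1.
case: (split_ordP j) => j' -> ji; last first.
  rewrite block_mxEdr !mulmxA; move: (hT2 i' j'); rewrite -/L -/L' !mulmxA; apply.
  by move: ji; rewrite /= !add1n.
rewrite block_mxEdl -mulmxA.
have -> : T1 *m c = pid_mx (\rank c) *m row_ebase c.
  by rewrite -{1}[c]mulmx_ebase -!mulmxA mulKmx // col_ebase_unit.
set w : 'cV_(1 + n) := _ *m row_ebase c.
have -> : w = col_mx (usubmx w) 0.
  rewrite -[LHS]vsubmxK; congr col_mx.
  apply/matrixP=> k l; rewrite !mxE big1 // => q _.
  by rewrite !mxE ord1 mul0r.
have -> : L *m col_mx (usubmx w) 0 = col_mx (usubmx w) 0.
  by rewrite mul_block_col !mulmx0 !mul0mx !addr0 mul1mx.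
by case: (split_ordP (i' : 'I_(1 + n))) ji => i'' -> ji;
  [rewrite !ord1 in ji | exact: etrans (col_mxEd _ _ _ _) (mxE _ _ _ _)].
Qed.

Lemma hessenberg_reduction {K : fieldType} {n : nat} (A : 'M[K]_n) :
  exists S H : 'M[K]_n, [/\ S \in unitmx, A *m S = S *m H & hessenberg H].
Proof.
case: n A => [|n] A.
  by exists 1%:M, A; split; [exact: unitmx1 | rewrite mul1mx mulmx1 | case].
have [T uT hT] := hessenberg_reduction_fix0 A.
set L := block_mx _ _ _ T in hT; set L' := block_mx _ _ _ _ in hT.
have LL' : L *m L' = 1%:M.
  by rewrite mulmx_block !mulmx0 !mul0mx !mul1mx !addr0 !add0r mulmxV // -scalar_mx_block.
exists L', (L *m (A : 'M_(1 + n)) *m L'); split=> //; first by have [] := mulmx1_unit LL'.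
by rewrite !mulmxA (mulmx1C LL') mul1mx.
Qed.

(** * Normal form of an unreduced Hessenberg matrix *)

(* r`_s = - s says that the roots of r add up to s; each division by X - 1 lowers
   this sum by one, so the last quotient of degree one is X itself. *)
Lemma synthetic_divisions {K : fieldType} (s : nat) (r : {poly K}) :
    r \is monic -> size r = s.+2 -> r`_s = - s%:R ->
  exists (f : nat -> {poly K}) (c : nat -> K),
  [/\ f 0 = 1, f 1 = 'X, f s.+1 = r,
      (forall k, (k <= s.+1)%N -> f k \is monic /\ size (f k) = k.+1) &
      forall k, (0 < k <= s)%N -> 'X * f k = f k.+1 + f k + (c k)%:P].
Proof.
elim: s r => [|s IHs] r r1 sr rs.
  exists (fun k => 'X^k), (fun=> 0); split=> // [|k _|[]//].
    apply/polyP=> -[|[|k]]; rewrite !coefE /=.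
    - by rewrite rs oppr0.
    - by move: r1; rewrite monicE lead_coefE sr => /eqP.
    by rewrite nth_default // sr.
  by rewrite monicXn size_polyXn.
pose l : {poly K} := 'X - 1%:P.
have l1 : l \is monic by exact: monicXsubC.
have sl : size l = 2%N by exact: size_XsubC.
have l0 := monic_neq0 l1.
have srl : size (r %/ l) = s.+2 by rewrite size_divp // sr sl subn1.
have [e Er] : exists e, r = (r %/ l) * l + e%:P.
  exists (r %% l)`_0; rewrite {1}(divp_eq r l); congr (_ + _).
  by apply/size1_polyC; rewrite -ltnS -sl ltn_modp.
have rl1 : r %/ l \is monic.
  move: r1; rewrite {1}Er monicE lead_coefDl; first
    by rewrite lead_coefM (monicP l1) mulr1.
  have rl0 : r %/ l != 0 by rewrite -size_poly_eq0 srl.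
  by rewrite size_Mmonic // srl sl size_polyC addn2; case: (_ != 0).
have rls : (r %/ l)`_s = - s%:R.
  have rlS : (r %/ l)`_s.+1 = 1.
    by move/monicP: rl1; rewrite lead_coefE srl.
  move: rs; rewrite {1}Er coefD coefC /= addr0 mulrBr mulr1 coefB coefMX /= rlS => rs.
  by apply: (addIr (- 1)); rewrite rs mulrS opprD addrC.
have [f [c [f0 f1 fs fm fc]]] := IHs _ rl1 srl rls.
(* The induction gives [f s.+1 = r %/ l], so [r = f s.+1 * ('X - 1) + e], that is,
   ['X * f s.+1 = r + f s.+1 - e]. *)
exists (fun k => if k == s.+2 then r else f k),
  (fun k => if k == s.+1 then - e else c k).
split=> // [|k|k]; first by rewrite eqxx.
  by rewrite leq_eqVlt; case: eqP => [->|_ /fm].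
move=> /andP[k0]; rewrite leq_eqVlt ltnS eqSS; case: eqP => [-> _|kNs /= ks].
  rewrite (ltn_eqF (ltnSn _)) fs polyCN {2}Er /l; ring.
by rewrite (ltn_eqF (_ : k < s.+2)%N) ?fc ?k0 // ltnS ltnW.
Qed.

(** Unreduced usually means that the subdiagonal entries are nonzero; here they are normalized to
    1. *)
Definition unreduced_hessenberg {K : fieldType} {n : nat} (H : 'M[K]_n) :=
  hessenberg H /\ forall i j : 'I_n, i = j.+1 :> nat -> H i j = 1.

(** The vector C^k e_0 is e_k plus a combination of earlier basis vectors. This makes the change of
    basis below triangular. *)
Lemma horner_unreduced_hessenberg {K : fieldType} {n : nat} (C : 'M[K]_n.+1)
    (q : {poly K}) (i : 'I_n.+1) :
  unreduced_hessenberg C -> (size q <= i.+1)%N ->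
  (horner_mx C q *m delta_mx 0 0 : 'cV_n.+1) i 0 = q`_i.
Proof.
move=> [C0 C1]; elim/poly_ind: q i => [|q c IHq] i sq.
  by rewrite rmorph0 mul0mx mxE coef0.
have {}sq : (size q <= i)%N.
  by move: sq; rewrite size_MXaddC; case: ifP => [/andP[/eqP-> _]|//]; rewrite size_poly0.
rewrite [q * 'X]mulrC rmorphD rmorphM /= horner_mx_X horner_mx_C.
rewrite mulmxDl -mulmxA mul_scalar_mx !mxE coefD coefXM coefC eqxx andbT -val_eqE /=.
have -> : c * (i == 0%N :> nat)%:R = if i == 0%N :> nat then c else 0.
  by case: ifP; rewrite ?mulr1 ?mulr0.
congr (_ + _); have [i0 | i_gt0] := posnP i.
  move: sq; rewrite i0 leqn0 size_poly_eq0 => /eqP->.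
  by rewrite big1 // => k _; rewrite rmorph0 mul0mx mxE mulr0.
have lt_i1 : (i.-1 < n.+1)%N by rewrite (leq_ltn_trans (leq_pred _)).
(* Only the index [i.-1] contributes: smaller ones are killed by the Hessenberg shape, larger ones
   by the degree of [q]. *)
rewrite (bigD1 (Ordinal lt_i1)) //= C1 ?prednK // mul1r IHq /= ?prednK //.
rewrite big1 ?addr0 // => k; rewrite -val_eqE /= => ki.
have [lt_ki | le_ik] := ltnP k i; first by rewrite C0 ?mul0r //; lia.
by rewrite IHq ?nth_default ?mulr0 // (leq_trans sq) // leqW.
Qed.

Lemma sum_ord_delta {V : nmodType} (N t : nat) (F : nat -> V) :
  \sum_(i < N) F i *+ (i == t :> nat) = F t *+ (t < N)%N.
Proof.
under eq_bigr do rewrite mulrb.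
by rewrite -big_mkcond big_ord1_eq mulrb.
Qed.

(** [M] is multiplication by X modulo the characteristic polynomial, in the basis [p j]. The entries
    with [i <= m < j] stay free, as they will form the block Y of an idempotent. Since [0 < s], the
    last column lies beyond [m], so the remainder [e] of degree below [m] falls into this block. *)
Lemma unreduced_hessenberg_normal_form {K : fieldType} (m s : nat)
    (C : 'M[K]_((m + s).+1)) :
    (0 < s)%N -> unreduced_hessenberg C -> \tr C = s%:R ->
  exists B M : 'M[K]_((m + s).+1), [/\ B \in unitmx, C *m B = B *m M &
    forall i j : 'I_(m + s).+1, ~~ (i <= m < j)%N ->
      M i j = (i == j.+1 :> nat)%:R + ((i == j) && (m < j)%N)%:R].
Proof.
move=> s_gt0 hC trC; set N := (m + s).+1 in C hC trC *.
pose chi := char_poly C; pose r := chi %/ 'X^m; pose e := chi %% 'X^m.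
have Echi : chi = 'X^m * r + e by rewrite mulrC -divp_eq.
have X0 : 'X^m != 0 :> {poly K} by rewrite monic_neq0 ?monicXn.
have se : (size e <= m)%N by rewrite -ltnS -(size_polyXn K m) ltn_modp.
have schi : size chi = N.+1 by rewrite size_char_poly.
have sr : size r = s.+2 by rewrite size_divp // schi size_polyXn /=; lia.
have coefr k : r`_k = chi`_(m + k).
  rewrite Echi coefD coefXnM ltnNge leq_addr /= addKn.
  by rewrite [e`__]nth_default ?addr0 // (leq_trans se) // leq_addr.
have r1 : r \is monic.
  rewrite monicE lead_coefE sr coefr /= addnS.
  by have /monicP := char_poly_monic C; rewrite lead_coefE -/chi schi => ->.
(* The second highest coefficient of [chi], shared by [r], is minus the trace. *)
have rs : r`_s = - s%:R by rewrite coefr -trC -(char_poly_trace C).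
have [f [c [f0 f1 fs fm fc]]] := synthetic_divisions _ _ r1 sr rs.
pose p j := if (j < m)%N then 'X^j else 'X^m * f (j - m)%N.
have pX j : (j <= m)%N -> p j = 'X^j.
  by rewrite /p; case: ltngtP => // ->; rewrite subnn f0 mulr1.
have pm j : (j < N)%N -> p j \is monic /\ size (p j) = j.+1.
  move=> jN; have [jm | mj] := leqP j m; first by rewrite pX // monicXn size_polyXn.
  have /fm[fm1 fm2] : (j - m <= s.+1)%N by lia.
  rewrite /p ltnNge (ltnW mj) /= rpredM ?monicXn // size_monicM ?monicXn ?monic_neq0 //.
  by rewrite size_polyXn fm2; split=> //=; lia.
have pS j : (j < N)%N -> 'X * p j = p j.+1 + (m < j)%N%:R *: (p j + c (j - m)%N *: p m).
  move=> jN; have [mj | jm] := ltnP m j; last first.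
    rewrite scale0r addr0 [p j]pX // -exprS.
    move: jm; rewrite leq_eqVlt => /orP[/eqP-> | jm]; last by rewrite pX.
    by rewrite /p ltnNge leqnSn /= subSnn f1 exprSr.
  rewrite scale1r (pX m) // /p !ifN -?leqNgt ?leqW ?(ltnW mj) // subSn ?(ltnW mj) //.
  rewrite mulrCA fc; last lia.
  by rewrite !mulrDr addrA -mul_polyC [_%:P * _]mulrC.
pose phi (q : {poly K}) : 'cV_N := horner_mx C q *m delta_mx 0 0.
have phiE (q : {poly K}) (i : 'I_N) : (size q <= i.+1)%N -> phi q i 0 = q`_i.
  exact: horner_unreduced_hessenberg.
pose B : 'M[K]_N := \matrix_(i, j) phi (p j) i 0.
(* The columns are read off from [pS]. In the last one [p j.+1] is ['X^m * r = chi - e], which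
   becomes [- e] modulo [chi]. *)
pose M : 'M[K]_N := \matrix_(i, j) ((i == j.+1 :> nat)%:R +
  (m < j)%N%:R * ((i == j :> nat)%:R + c (j - m)%N * (i == m :> nat)%:R) -
  (j == m + s :> nat)%N%:R * e`_i).
have BE i j : B i j = phi (p j) i 0 by rewrite mxE.
have col_B j : col j B = phi (p j) by apply/matrixP=> i k; rewrite mxE BE ord1.
exists B, M; split; last 1 first.
- move=> i j ij; rewrite mxE -val_eqE.
  have [mj | jm] := ltnP m j; last first.
    by rewrite mul0r addr0 andbF (_ : (j == m + s :> nat)%N = false)
      ?mul0r ?subr0 ?addr0 //; lia.
  have mi : (m < i)%N by move: ij; rewrite mj andbT -ltnNge.
  rewrite nth_default ?(leq_trans se (ltnW mi)) // (gtn_eqF mi) !mulr0 !mul1r andbT.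
  by rewrite subr0 addr0.
(* [B] is upper triangular with unit diagonal, because [p j] is monic of degree [j]. *)
- rewrite -unitmx_tr unitmxE det_trig.
    rewrite big1 ?unitr1 // => i _; have [pi1 spi] := pm i (ltn_ord i).
    rewrite mxE BE phiE ?spi //.
    by move/monicP: pi1; rewrite lead_coefE spi.
  apply/is_trig_mxP=> i j ij; have [_ spi] := pm i (ltn_ord i).
  rewrite mxE BE phiE ?spi ?nth_default ?spi // ltnW //.
apply/trmx_inj/row_matrixP=> j; rewrite -!tr_col; congr _^T.
rewrite !colE -!mulmxA -!colE col_B.
have -> : C *m phi (p j) = phi ('X * p j).
  by rewrite /phi rmorphM /= horner_mx_X -mulmxE mulmxA.
have -> : B *m col j M = phi (\sum_(i < N) M i j *: p i).
  rewrite [in RHS]/phi rmorph_sum mulmx_suml; apply/matrixP=> i k.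
  rewrite summxE [LHS]mxE; apply: eq_bigr => l _.
    by rewrite BE /= horner_mxZ -scalemxAl -/(phi _) ord1 [X in _ * X]mxE [RHS]mxE mulrC.
(* An identity of polynomials; the multiple of [chi] disappears by Cayley-Hamilton. *)
have -> : \sum_(i < N) M i j *: p i = 'X * p j - (j == m + s :> nat)%N%:R *: chi.
  rewrite pS //.
  transitivity (\sum_(i < N) (p i *+ (i == j.+1 :> nat)
     + (m < j)%N%:R *: (p i *+ (i == j :> nat)
                          + c (j - m)%N *: (p i *+ (i == m :> nat)))
     - (j == m + s :> nat)%N%:R *: (e`_i *: 'X^i))).
    apply: eq_bigr => i _; rewrite mxE.
    have -> : e`_i *: 'X^i = e`_i *: p i.
      have [im | mi] := ltnP i m; first by rewrite pX // ltnW.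
      by rewrite nth_default ?scale0r // (leq_trans se).
    by rewrite -!scaler_nat !scalerA -scalerDl scalerA -scalerDl -scalerBl.
  rewrite !big_split /= sumrN -!scaler_sumr !big_split /= -!scaler_sumr !sum_ord_delta.
  have -> : \sum_(i < N) e`_i *: 'X^i = e.
    rewrite -poly_def; apply/polyP=> k; rewrite coef_poly.
    by case: ltnP => // Nk; rewrite nth_default // (leq_trans se) //; lia.
  have -> : (m < N)%N by rewrite ltnS leq_addr.
  rewrite ltn_ord !mulr1n; have := ltn_ord j; rewrite ltnS leq_eqVlt.
  have [-> _ | _ /= js] := eqVneq (j : nat) (m + s)%N; last
    by rewrite ltnS js !scale0r mulr1n.
  have -> : p (m + s).+1 = 'X^m * r.
    by rewrite /p ltnNge leqW ?leq_addr //= subSn ?leq_addr // addKn fs.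
  rewrite ltnn mulr0n add0r !scale1r Echi.
  by set t := _ *: _; ring.
by rewrite /phi rmorphB mulmxBl /= horner_mxZ Cayley_Hamilton scaler0 mul0mx subr0.
Qed.

(** * Sums of three and of five idempotents *)

Lemma unreduced_hessenberg_sum {K : fieldType} {n s : nat} (C : 'M[K]_n) :
    (0 < s < n)%N -> unreduced_hessenberg C -> \tr C = (n + s)%:R ->
  sum_of_idempotents 3 C.
Proof.
move=> /andP[s_gt0 sn]; have [m En] : exists m, n = (m + s).+1.
  by exists (n - s.+1)%N; lia.
subst n => {sn} -[C0 C1] trC.
have [||B [M [uB CB ME]]] := unreduced_hessenberg_normal_form m s (C - 1%:M) s_gt0.
- split=> i j ij; rewrite !mxE -val_eqE /=.
    by rewrite C0 // (gtn_eqF (ltnW ij)) subr0.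
  by rewrite C1 // ij (gtn_eqF (ltnSn j)) subr0.
- by rewrite linearB /= trC mxtrace1 natrD addrC addKr.
apply: (sum_of_idempotents_similar B C (1%:M + M) uB).
  by rewrite mulmxDr mulmx1 -CB mulmxBl mul1mx addrC subrK.
pose X i j := M (inord i) (inord j).
suff -> : 1%:M + M =
    (* The columns beyond [m], without their subdiagonal ones, are [[Y], [1]], which is a column
       idempotent. *)
    bidiagonal _ false (fun=> 1) + column_idempotent _ (fun j => m < j)%N X.
  by apply: (@sum_of_idempotentsD _ _ 2 1);
    [exact: bidiagonal_sum | exact/sum_of_idempotents1/column_idempotentP].
apply/matrixP=> i j; rewrite !mxE /= /X !inord_val addr0 -addrA; congr (_ + _).
have [mj | jm] := ltnP m j; last first.
  by rewrite ME (ltnNge m j) jm ?andbF // !addr0; case: (i == j.+1 :> nat)%N.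
have [mi | im] := ltnP m i.
  by rewrite ME ?(leqNgt i m) ?mi // mj andbT; case: (i == j.+1 :> nat)%N.
by rewrite (_ : (i == j.+1 :> nat)%N = false) ?add0r //; lia.
Qed.

Lemma mxtrace_bidiagonal {K : fieldType} (n : nat) (e : bool) (x : nat -> K) :
  \tr (bidiagonal n.+1 e x) = (n.+1 + e)%:R.
Proof.
rewrite /mxtrace; under eq_bigr do rewrite mxE eqxx (ltn_eqF (ltnSn _)) addr0.
rewrite big_split /= sumr_const card_ord natrD; congr (_ + _).
rewrite big_ord_recl big1 => [|i _]; first by rewrite /= andbT addr0.
by rewrite andbF.
Qed.

Lemma sum_of_five_idempotents {K : fieldType} {n t : nat} (A : 'M[K]_n) :
    (2 <= n)%N -> (2 * n < t <= 3 * n)%N -> \tr A = t%:R ->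
  sum_of_idempotents 5 A.
Proof.
case: n A => // n A n_ge2 t_bounds trA.
have [S [H [uS AS hH]]] := hessenberg_reduction A.
apply: (sum_of_idempotents_similar S A H uS AS).
have trH : \tr H = t%:R by rewrite -trA -(mulKmx uS H) -AS mxtrace_mulC mulmxK.
(* After the subtraction the trace is [n.+1 + s] with [s = t - 2 * n.+1 - e]. For [t = 3 * n.+1] the
   flag brings [s] down from [n.+1] to [n], still positive because the size is at least 2. *)
pose e := (t == 3 * n.+1)%N.
(* Chosen so that every subdiagonal entry of the difference is 1. *)
pose x j := H (inord j.+1) (inord j) - 1.
rewrite -(subrK (bidiagonal _ e x) H).
apply: (@sum_of_idempotentsD _ _ 3 2); last exact: bidiagonal_sum.
apply: (@unreduced_hessenberg_sum _ _ (t - 2 * n.+1 - e)); first by rewrite /e; lia.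
  split=> i j ij; rewrite !mxE -val_eqE /=.
    rewrite hH // (gtn_eqF ij) (gtn_eqF (ltnW ij)).
    by rewrite (gtn_eqF (leq_ltn_trans (leq0n _) ij)) andbF !addr0 subr0.
  by rewrite ij (gtn_eqF (ltnSn j)) eqxx andbF !add0r /x -ij !inord_val subKr.
rewrite linearB /= trH mxtrace_bidiagonal.
apply: (canLR (addrK _)); rewrite -natrD; congr (_%:R); rewrite /e; lia.
Qed.

(** * Arbitrary traces in the prime subfield *)

Lemma idempotent_bound_pchar {K : fieldType} {p n : nat} :
    p \in [pchar K] -> (2 <= n)%N ->
  idempotent_bound K n (5 + (p - 1) %/ n).
Proof.
move=> charKp n_ge2 A /(in_prime_subfieldP _ charKp)[k trA].
have p_gt0 := prime_gt0 (pcharf_prime charKp).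
(* The residue of [k - (2 * n).+1] modulo [p]; the added multiple of [p] keeps the natural
   subtraction from truncating. Writing [l = q * n + r] and removing [q] identity matrices leaves
   the trace [(2 * n).+1 + r], between [(2 * n).+1] and [3 * n]. *)
pose l := ((k + p * (2 * n).+1 - (2 * n).+1) %% p)%N.
have lp : (l < p)%N by rewrite ltn_mod.
have [q [r [El rn qp]]] : exists q r,
    [/\ l = (q * n + r)%N, (r < n)%N & (q <= (p - 1) %/ n)%N].
  exists (l %/ n)%N, (l %% n)%N; rewrite -divn_eq ltn_mod; split=> //; first lia.
  by apply: leq_div2r; lia.
have Ek : k%:R = (q * n + ((2 * n).+1 + r))%:R :> K.
  have -> : k%:R = (k + p * (2 * n).+1)%:R :> K.
    by rewrite natrD natrM (pcharf0 charKp) mul0r addr0.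
  have le2n : ((2 * n).+1 <= k + p * (2 * n).+1)%N.
    by rewrite (leq_trans (leq_pmull _ p_gt0)) ?leq_addl.
  rewrite -(subnK le2n) (divn_eq (_ - _) p) -/l El !natrD natrM (pcharf0 charKp) mulr0.
  ring.
apply: (@sum_of_idempotents_leq _ _ (5 + q)); first by rewrite leq_add2l.
rewrite -(subrK (1%:M *+ q) A); apply: sum_of_idempotentsD.
  apply: (@sum_of_five_idempotents _ _ ((2 * n).+1 + r)) => //; first lia.
  rewrite linearB /= linearMn /= mxtrace1 trA Ek natrD natrM -mulrnA mulnC.
  ring.
exact/sum_of_idempotents_nseq/mulmx1.
Qed.

Theorem theorem7 (K : fieldType) (p : nat) (charKp : p \in [pchar K])
    (n : nat) (n_ge2 : (2 <= n)%N) :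
  (exists s : nat, is_s K n s /\ (s <= 5 + (p - 1) %/ n)%N) /\
  ((p <= n)%N ->
   forall A : 'M[K]_n, in_prime_subfield (\tr A) -> sum_of_idempotents 5 A).
Proof.
have bound := idempotent_bound_pchar charKp n_ge2.
split=> [|le_pn]; last first.
  have p_gt0 := prime_gt0 (pcharf_prime charKp).
  by move: bound; rewrite divn_small ?addn0 //; lia.
(* The least bound exists by classical descent, as being a bound is not a decidable predicate here.
   Carrying the inequality along gives the estimate for the least bound too. *)
apply: NNPP => no_s.
suff noN N : ~ (idempotent_bound K n N /\ (N <= 5 + (p - 1) %/ n)%N).
  exact: noN (conj bound (leqnn _)).
elim/ltn_ind: N => N IHN [boundN leN]; apply: no_s.
exists N; split=> //; split=> // N' boundN'.
rewrite leqNgt; apply/negP=> ltN; apply: (IHN _ ltN); split=> //.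
exact: leq_trans (ltnW ltN) leN.
Qed.
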